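(* Fix an integer $m\geq2$. There exists $N$ (depending on $m$) such that for every finite group $G$ of order $n\geq N$: (i) the proportion of set-matrices $\mathcal{S}$ of $G$ such that $m\text{-}\mathrm{Cay}(G,\mathcal{S})$ is a DMSR is greater than $1-m^2/\sqrt{n}$; and (ii) the proportion of inverse-closed set-matrices $\mathcal{S}$ of $G$ such that $m\text{-}\mathrm{Cay}(G,\mathcal{S})$ is a GMSR is greater than $1-m^2/\sqrt{n}$.
   Context: A set-matrix of a group $G$ is an $m\times m$ matrix $\mathcal{S}=(S_{i,j})$ whose entries are subsets of $G$. The $m$-Cayley digraph $m\text{-}\mathrm{Cay}(G,\mathcal{S})$ has vertex set $G\times\{1,\ldots,m\}$ and arc set $\{((g,i),(sg,j)) : i,j\in\{1,\ldots,m\},\ s\in S_{i,j},\ g\in G\}$. $\mathcal{S}$ is inverse-closed if $S_{j,i}=S_{i,j}^{-1}$ for all $i,j$; then $m\text{-}\mathrm{Cay}(G,\mathcal{S})$ is an (undirected) graph. Each $x\in G$ acts as an automorphism $(g,i)\mapsto(gx,i)$. An $m$-Cayley digraph (resp. graph) of $G$ is a DMSR (resp. GMSR) if its automorphism group is isomorphic to $G$. Proportions are taken among all set-matrices (resp. all inverse-closed set-matrices) of $G$. *)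

(* Defs.v *)
From HB Require Import structures.
From mathcomp Require Import all_boot all_order all_algebra all_fingroup.
From mathcomp Require Import reals.

Set Implicit Arguments.
Unset Strict Implicit.
Unset Printing Implicit Defensive.

Import Order.TTheory GRing.Theory Num.Theory.

Section DigraphAut.
Variables (T : finType) (e : rel T).

Definition digraph_aut : {set {perm T}} :=
  [set p : {perm T} | [forall u, forall v, e (p u) (p v) == e u v]].

Lemma digraph_autP (p : {perm T}) :
  reflect (forall u v, e (p u) (p v) = e u v) (p \in digraph_aut).
Proof.
rewrite inE; apply: (iffP forallP) => [H u v | H u].
  by move/forallP/(_ v)/eqP: (H u).
by apply/forallP => v; rewrite H.
Qed.

Lemma digraph_aut_group_set : group_set digraph_aut.
Proof.
apply/group_setP; split; first by apply/digraph_autP => u v; rewrite !perm1.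
move=> p q /digraph_autP Hp /digraph_autP Hq.
by apply/digraph_autP => u v; rewrite !permM Hq Hp.
Qed.

Canonical digraph_aut_group := Group digraph_aut_group_set.

End DigraphAut.

Section MCayley.
Local Open Scope group_scope.
Variables (gT : finGroupType) (m : nat).

Definition set_matrix := 'M[{set gT}]_m.

(* 'I_m = {0, ..., m - 1} plays the role of {1, ..., m}.  Loops are allowed: *)
(* a diagonal entry may contain the identity.                                *)
Definition mCay (S : set_matrix) : rel (gT * 'I_m) :=
  fun u v => [exists s in S u.2 v.2, v.1 == s * u.1].

Definition inverse_closed (S : set_matrix) : bool :=
  [forall i, forall j, S j i == (S i j)^-1].

Lemma inverse_closed_mCay_sym (S : set_matrix) :
  inverse_closed S -> symmetric (mCay S).
Proof.
move=> /forallP HS; have {}HS i j : S j i = (S i j)^-1.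
  by apply/eqP; move/forallP: (HS i); apply.
suff H u v : mCay S u v -> mCay S v u by move=> u v; apply/idP/idP; apply: H.
case/exists_inP=> s sS /eqP vE; apply/exists_inP; exists s^-1.
  by rewrite HS inE invgK.
by rewrite vE mulKg.
Qed.

Lemma mCay_right_translation (S : set_matrix) (x : gT) (u v : gT * 'I_m) :
  mCay S (u.1 * x, u.2) (v.1 * x, v.2) = mCay S u v.
Proof.
by apply: eq_existsb => s /=; rewrite mulgA (inj_eq (mulIg x)).
Qed.

Definition is_DMSR (S : set_matrix) : bool :=
  digraph_aut (mCay S) \isog [set: gT].

Definition is_GMSR (S : set_matrix) : bool :=
  inverse_closed S && (digraph_aut (mCay S) \isog [set: gT]).

End MCayley.

Section Proportion.
Local Open Scope ring_scope.

Definition proportion (R : realType) (T : finType) (A P : pred T) : R :=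
  #|[pred x | A x & P x]|%:R / #|A|%:R.

End Proportion.

(* Main.v *)
(** A random set-matrix gives distinct outdegrees to the [m] copies of [G] except
with probability [O(m^2 / sqrt n)], by the bound on central binomial coefficients;
every other failure has exponentially small probability.  If the outdegrees are
distinct, an automorphism is a family [(phi_i)] of permutations of [G], where
[phi_i] is an automorphism of [Cay(G, S_ii)].  With high probability
[g |-> d g] changes membership in [S_ii] for many [g], whenever [d <> 1]; hence a
small set of vertices distinguishes all others and [Cay(G, S_ii)] has only
[2 ^ o(n)] automorphisms.  Exposing the diagonal first, a pair [(phi_0, phi_j)] of
such automorphisms which is not a common right translation is compatible with the
random set [S_0j] with probability at most [2 ^ (- n / 12)], because it forces [S_0j]
to be invariant under a permutation of [G] moving at least half of the points.  A
union bound leaves only the right translations.  The entry [S_0j] with [j <> 0] is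
unrestricted even for inverse-closed matrices, so graphs and digraphs are treated
alike. *)

Require Import Defs.
From HB Require Import structures.
From mathcomp Require Import all_boot all_order all_algebra all_fingroup.
From mathcomp Require Import reals zify ring lra.

Set Implicit Arguments.
Unset Strict Implicit.
Unset Printing Implicit Defensive.

Import Order.TTheory GRing.Theory Num.Theory.

(** * Subsets closed under an involution *)

Lemma card_bigcup_leq (I T : finType) (P : pred I) (A : I -> {set T}) :
  #|\bigcup_(i | P i) A i| <= \sum_(i | P i) #|A i|.
Proof.
elim/big_rec2: _ => [|i n B _ IH]; first by rewrite cards0.
by apply: leq_trans (leq_card_setU _ _) _; rewrite leq_add2l.
Qed.

(** The induction step multiplies the coefficient by [2 (2l + 1) / (l + 1)], and
    [(2l + 1) (2l + 3) <= 4 (l + 1)^2]. *)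
Lemma central_bin_even l : 'C(l.*2, l) ^ 2 * l.*2.+1 <= 4 ^ l.*2.
Proof.
elim: l => [|l IH]; first by rewrite bin0.
have E : l.+1 * 'C(l.+1.*2, l.+1) = 2 * l.*2.+1 * 'C(l.*2, l).
  have h1 : l.+1 * 'C(l.*2.+1, l.+1) = l.*2.+1 * 'C(l.*2, l).
    by rewrite mul_bin_diag.
  have h2 : 'C(l.*2.+1, l) = 'C(l.*2.+1, l.+1).
    by rewrite -bin_sub; [congr 'C(_, _); lia | lia].
  by rewrite doubleS binS h2 mulnDr h1; lia.
have l2 : 0 < l.+1 ^ 2 by rewrite expn_gt0.
rewrite -(leq_pmul2l l2) mulnA -expnMn E doubleS !expnS expn0.
move: IH; set c := 'C(_, _); set p := 4 ^ _; rewrite !expnS expn0; nia.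
Qed.

Lemma central_bin k : 'C(k, k./2) ^ 2 * k.+1 <= 4 ^ k.
Proof.
have [ok|ek] := boolP (odd k); last first.
  have {1 3 4}-> : k = k./2.*2 by lia.
  exact: central_bin_even.
have := central_bin_even k./2.+1.
have h2 : 'C(k./2.+1.*2, k./2.+1) = 2 * 'C(k, k./2).
  have {1}-> : k./2.+1.*2 = k.+1 by lia.
  rewrite binS; have {1}-> : k./2.+1 = k - k./2 by lia.
  by rewrite bin_sub; lia.
have -> : k./2.+1.*2 = k.+1 by lia.
have {1}-> : k./2.+1 = k.+1./2 by lia.
have h3 : 'C(k.+1, k.+1./2) = 2 * 'C(k, k./2).
  by rewrite -h2; congr 'C(_, _); lia.
by rewrite h3 [4 ^ _.+1]expnS; move: ('C(_, _)) (4 ^ _) => c p; nia.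
Qed.

Lemma bin_leq_central k j : 'C(k, j) <= 'C(k, k./2).
Proof.
have mono d : d <= k./2 -> 'C(k, k./2 - d) <= 'C(k, k./2).
  elim: d => [|d IH] ltd; first by rewrite subn0.
  apply: leq_trans (IH (ltnW ltd)); have := mul_bin_left k (k./2 - d.+1).
  have -> : (k./2 - d.+1).+1 = k./2 - d by lia.
  by set x := 'C(_, _); set y := 'C(_, _) => E; nia.
have [jle|jgt] := leqP j k./2.
  by have := mono (k./2 - j); rewrite subKn // leq_subr => ->.
have [jk|jk] := leqP j k; last by rewrite bin_small.
rewrite -bin_sub //; have := mono (k./2 - (k - j)).
by rewrite leq_subr subKn => [->//|]; lia.
Qed.

Section FlipClosed.
Variables (V : finType) (iota : V -> V).
Hypothesis iotaK : involutive iota.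

Definition flip_closed (T : {set V}) := [forall y, (iota y \in T) == (y \in T)].

Lemma flip_closedP (T : {set V}) :
  reflect (forall y, (iota y \in T) = (y \in T)) (flip_closed T).
Proof. by apply: (iffP forallP) => H y; apply/eqP. Qed.

Definition flip_hull (K : {set V}) := K :|: iota @: K.

Lemma in_flip_imset (K : {set V}) y : (y \in iota @: K) = (iota y \in K).
Proof.
by rewrite -{1}[y]iotaK (mem_imset _ _ (can_inj iotaK)).
Qed.

Lemma in_flip_hull K y : (y \in flip_hull K) = (y \in K) || (iota y \in K).
Proof. by rewrite inE in_flip_imset. Qed.

Lemma flip_hull_closed K y : (iota y \in flip_hull K) = (y \in flip_hull K).
Proof. by rewrite !in_flip_hull iotaK orbC. Qed.

(** A flip-closed set is determined by its traces on [K] and outside [flip_hull K]. Since [K] meets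
    each orbit of [iota] at most once, an outside trace occurring in [E] extends in [2 ^ #|K|] ways
    to a member of [F], but in at most [c] ways to a member of [E]. *)
Lemma fibre_bound (K : {set V}) (F E : {set {set V}}) c :
    (forall y, y \in K -> iota y \in K -> iota y = y) ->
    E \subset F -> (forall T, T \in E -> flip_closed T) ->
    (forall T U, T \in F -> flip_closed U ->
       U :\: flip_hull K = T :\: flip_hull K -> U \in F) ->
    (forall T0 : {set V}, #|[set T :&: K | T in E & T :\: flip_hull K == T0]| <= c) ->
  #|E| * 2 ^ #|K| <= c * #|F|.
Proof.
move=> Kfix sEF clE Fsat fibre.
set Z := flip_hull K in Fsat fibre *.
pose B := [set T :\: Z | T : {set V} in E].
have leE : #|E| <= c * #|B|.
  rewrite -sum1_card (partition_big (fun T => T :\: Z) (mem B)) /=; last first.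
    by move=> T TE; apply: imset_f.
  rewrite mulnC -sum_nat_const; apply: leq_sum => T0 _.
  rewrite sum1_card; apply: leq_trans (fibre T0).
  rewrite -(@card_in_imset _ _ (fun T => T :&: K)) //; last first.
    move=> T U /andP[TE /eqP TZ] /andP[UE /eqP UZ] eqK.
    apply/setP => y; have [yZ|yZ] := boolP (y \in Z); last first.
      by have := congr1 (fun X : {set V} => y \in X) (etrans TZ (esym UZ)); rewrite !in_setD yZ.
    have [/flip_closedP Tc /flip_closedP Uc] := (clE _ TE, clE _ UE).
    have eqKE z : z \in K -> (z \in T) = (z \in U).
      by move=> zK; have := congr1 (fun X : {set V} => z \in X) eqK; rewrite !inE zK !andbT.
    by move: yZ; rewrite in_flip_hull => /orP[/eqKE //|/eqKE]; rewrite Tc Uc.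
  apply: subset_leq_card; apply/subsetP => X /imsetP[T TP ->].
  by apply: imset_f; rewrite inE.
rewrite -card_powerset.
apply: leq_trans (_ : c * (#|B| * #|powerset K|) <= _).
  by rewrite mulnA leq_mul2r leE orbT.
rewrite leq_mul2l -cardsX; apply/orP; right.
(* [h] rebuilds a closed set from its trace outside [Z] and its trace on [K]. *)
pose h (p : {set V} * {set V}) := p.1 :|: (p.2 :|: iota @: p.2).
have outZ p : p \in setX B (powerset K) -> h p :\: Z = p.1 /\ h p :&: K = p.2.
  case: p => T0 W; rewrite inE /= powersetE => /andP[/imsetP[T TE ->] sWK].
  split; apply/setP => y; rewrite /h /= !inE in_flip_imset in_flip_imset.
    have [yK|nyK] := boolP (y \in K); have [iyK|niyK] := boolP (iota y \in K) => //=.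
    rewrite (contraNF (subsetP sWK y)) // (contraNF (subsetP sWK _) niyK) //.
    by rewrite !orbF.
  have [yK|nyK] /= := boolP (y \in K); last first.
    by rewrite andbF (contraNF (subsetP sWK y)).
  rewrite andbT; case yW: (y \in W) => //=.
  apply/negbTE/negP => iyW; have := Kfix _ yK (subsetP sWK _ iyW).
  by move=> E1; rewrite E1 yW in iyW.
rewrite -(@card_in_imset _ _ h); last first.
  move=> p q /outZ[p1 p2] /outZ[q1 q2] eqh.
  by rewrite [p]surjective_pairing [q]surjective_pairing -p1 -p2 -q1 -q2 eqh.
apply: subset_leq_card; apply/subsetP => X /imsetP[p pP ->].
have [pZ _] := outZ p pP.
case: p pP pZ => T0 W; rewrite inE /= powersetE => /andP[/imsetP[T TE ->] sWK] pZ.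
apply: (Fsat T) => //; first exact: (subsetP sEF).
apply/flip_closedP => y; rewrite /h [in LHS]inE [in RHS]inE /= ![_ \in _ :\: _]inE.
rewrite flip_hull_closed !in_flip_hull iotaK orbC [_ || _ in RHS]orbC.
by rewrite (flip_closedP _ (clE _ TE)); congr (_ || _); rewrite orbC.
Qed.

(* [Y] is a maximal subset of [M] on which the constraints are independent:
   every point of [M] is within one [f]-step of [Y] up to [iota]. *)
Lemma twist_bound (f : V -> V) (M D : {set V}) (F E : {set {set V}}) :
    injective f ->
    (forall y, y \in M -> f y != y /\ f y != iota y) ->
    E \subset F -> (forall T, T \in E -> flip_closed T) ->
    (forall T U, T \in F -> flip_closed U ->
       U :\: flip_hull M = T :\: flip_hull M -> U \in F) ->
    (forall T y, T \in E -> y \in M -> (f y \in T) = (y \in T) (+) (y \in D)) ->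
  exists2 r, #|M| <= 6 * r & #|E| * 2 ^ r <= #|F|.
Proof.
move=> f_inj Mf sEF clE Fsat twist.
pose indep (Y : {set V}) := (Y \subset M) &&
  [forall y in Y, forall z in Y, (y != z) ==>
     [&& iota y != z, f y != z & f y != iota z]].
have indep0 : indep set0.
  by rewrite /indep sub0set; apply/forall_inP => y; rewrite inE.
have [Y /maxsetP[/andP[sYM indY] maxY] _] := maxset_exists indep0.
have {}indY y z : y \in Y -> z \in Y -> y != z ->
    [&& iota y != z, f y != z & f y != iota z].
  by move=> yY zY; move/forall_inP: indY => /(_ y yY) /forall_inP/(_ z zY)/implyP.
exists #|Y|.
  (* By maximality [M] is covered by six sets of size at most [#|Y|], whence the factor 6. *)
  pose N := Y :|: iota @: Y :|: (f @: Y :|: iota @: (f @: Y)) :|: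
            (f @^-1: Y :|: f @^-1: (iota @: Y)).
  have sMN : M \subset N.
    apply/subsetP => z zM; apply: contraT => zN.
    have zY : z \notin Y by apply: contra zN => zY; rewrite !inE zY.
    suff indz : indep (z |: Y).
      by have := maxY _ indz (subsetUr _ _); move=> E1; rewrite -E1 setU11 in zY.
    rewrite /indep subUset sub1set zM sYM /=.
    have ziY : iota z \notin Y.
      by apply: contra zN => H; rewrite !inE !in_flip_imset H !orbT.
    have zfY y : y \in Y -> f y != z.
      move=> yY; apply: contra zN => /eqP <-; rewrite !inE.
      by rewrite (imset_f f yY) !orbT.
    have zifY y : y \in Y -> f y != iota z.
      move=> yY; apply: contra zN => /eqP E1; rewrite !inE in_flip_imset.
      by rewrite in_flip_imset -E1 (imset_f f yY) !orbT.
    have fzY : f z \notin Y by apply: contra zN => H; rewrite !inE H !orbT.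
    have fziY : iota (f z) \notin Y.
      by apply: contra zN => H; rewrite !inE !in_flip_imset H !orbT.
    apply/forall_inP => a /setU1P[->|aY]; apply/forall_inP => b /setU1P[->|bY];
      apply/implyP => ab.
    - by rewrite eqxx in ab.
    - apply/and3P; split.
      + by apply: contraNneq ziY => ->.
      + by apply: contraNneq fzY => ->.
      + by apply: contraNneq fziY => ->; rewrite iotaK.
    - apply/and3P; split.
      + by apply: contraNneq ziY => <-; rewrite iotaK.
      + exact: zfY.
      + exact: zifY.
    - exact: indY.
  apply: leq_trans (subset_leq_card sMN) _.
  have i_inj := can_inj iotaK.
  have cU (A B : {set V}) a b : #|A| <= a -> #|B| <= b -> #|A :|: B| <= a + b.
    by move=> *; apply: leq_trans (leq_card_setU _ _) (leq_add _ _).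
  have cI (A : {set V}) : #|A| <= #|Y| -> #|iota @: A| <= #|Y| by rewrite card_imset.
  have cP (A : {set V}) : #|A| <= #|Y| -> #|f @^-1: A| <= #|Y|.
    apply: leq_trans; rewrite -(card_imset (f @^-1: A) f_inj) subset_leq_card //.
    by apply/subsetP => _ /imsetP[z zA ->]; rewrite inE in zA.
  apply: leq_trans (_ : _ <= (#|Y| + #|Y|) + (#|Y| + #|Y|) + (#|Y| + #|Y|)) _;
    last by lia.
  have cf : #|f @: Y| <= #|Y| by rewrite card_imset.
  by do 2?apply: (cU); do ?apply: (cU); rewrite ?cI ?cP ?cI.
(* Here [c = 1]: for [y] in [Y] the point [f y] lies outside [flip_hull Y], so the outside trace
   already decides whether [y] is in [T]. *)
rewrite -(mul1n #|F|); apply: fibre_bound sEF clE _ _.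
- move=> y yY iyY; apply/eqP/negPn/negP => ne.
  by have := indY _ _ yY iyY; rewrite eq_sym ne eqxx => /(_ isT).
- move=> T U TF Uc E1; apply: (Fsat T) => //.
  have sZ : flip_hull Y \subset flip_hull M.
    by rewrite /flip_hull setUSS // imsetS.
  apply/setP => y; rewrite !in_setD; case yM: (y \in flip_hull M) => //=.
  have yY : y \notin flip_hull Y by apply: contraFN yM; apply: (subsetP sZ).
  by have := congr1 (fun X : {set V} => y \in X) E1; rewrite !in_setD yY.
- move=> T0; apply/card_le1_eqP => _ _ /imsetP[T TP ->] /imsetP[U UP ->].
  move: TP UP; rewrite !inE => /andP[TE /eqP TZ] /andP[UE /eqP UZ].
  apply/setP => y; rewrite !inE; case yY: (y \in Y); rewrite ?andbF ?andbT //.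
  have yM := subsetP sYM _ yY.
  have /eqP : (y \in T) (+) (y \in D) = (y \in U) (+) (y \in D).
    rewrite -!twist //.
    have fZ : f y \notin flip_hull Y.
      rewrite in_flip_hull negb_or; have [n1 n2] := Mf _ yM.
      apply/andP; split; apply/negP => fY.
        have ne : y != f y by rewrite eq_sym.
        by have /and3P[_] := indY _ _ yY fY ne; rewrite eqxx.
      have [e|ne] := eqVneq y (iota (f y)).
        by case/negP: n2; rewrite {2}e iotaK.
      by have /and3P[_ _] := indY _ _ yY fY ne; rewrite iotaK eqxx.
    by have := congr1 (fun X : {set V} => f y \in X) (etrans TZ (esym UZ)); rewrite !in_setD fZ.
  by case: (y \in T) (y \in U) (y \in D) => [] [] [].
Qed.

(** Once the trace outside [flip_hull K] is fixed, [level] prescribes the size of the trace on [K].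
    The fibres are thus bounded by a central binomial coefficient, which saves a factor of order
    [sqrt #|K|]. *)
Lemma level_bound_reps (K D : {set V}) (E : {set {set V}}) c :
    (forall y, y \in K -> iota y \in K -> iota y = y) ->
    flip_hull K \subset D -> 0 < c ->
    (forall T, flip_closed T -> #|T :&: flip_hull K| = c * #|T :&: K|) ->
    (forall T, T \in E -> flip_closed T) ->
    (forall T U, T \in E -> U \in E -> T :\: D = U :\: D ->
       #|T :&: D| = #|U :&: D|) ->
  #|E| ^ 2 * #|K|.+1 <= #|[set T | flip_closed T]| ^ 2.
Proof.
move=> Kfix sZD c0 cardZ clE level; set F := [set T | _].
have bnd : #|E| * 2 ^ #|K| <= 'C(#|K|, #|K|./2) * #|F|.
  apply: (fibre_bound Kfix) => //.
  - by apply/subsetP => T TE; rewrite inE clE.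
  - by move=> T U _ Uc _; rewrite inE.
  move=> T0; have [T1 /andP[T1E /eqP T1Z]|nT] :=
    pickP [pred T in E | T :\: flip_hull K == T0]; last first.
    apply: leq_trans (leq0n _); rewrite leqn0 cards_eq0 -subset0.
    by apply/subsetP => X /imsetP[T TP _]; have := nT T; rewrite inE in TP; rewrite /= TP.
  apply: leq_trans (bin_leq_central _ #|T1 :&: K|); rewrite -cards_draws.
  apply: subset_leq_card; apply/subsetP => X /imsetP[T].
  case/setIdP => TE /eqP TZ ->.
  rewrite inE subsetIr /=.
  rewrite -(eqn_pmul2l c0) -!cardZ ?clE //.
  have eqout : T :\: flip_hull K = T1 :\: flip_hull K by rewrite TZ T1Z.
  have eqD : T :\: D = T1 :\: D.
    apply/setP => y; rewrite !in_setD; case yD: (y \in D) => //=.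
    have yZ : y \notin flip_hull K by apply: contraFN yD; apply: (subsetP sZD).
    by have := congr1 (fun X : {set V} => y \in X) eqout; rewrite !in_setD yZ.
  have := level _ _ TE T1E eqD.
  have split U : #|U :&: D| = #|U :&: flip_hull K| + #|(U :\: flip_hull K) :&: D|.
    by rewrite -(cardsID (flip_hull K)) -setIA (setIidPr sZD) setIDAC.
  by rewrite (split T) (split T1) eqout => /eqP; rewrite eqn_add2r.
have square b k e f : e * 2 ^ k <= b * f -> b ^ 2 * k.+1 <= 4 ^ k ->
    e ^ 2 * k.+1 <= f ^ 2.
  move=> le cb; have p0 : 0 < 4 ^ k by rewrite expn_gt0.
  rewrite -(leq_pmul2l p0).
  have {1}-> : 4 ^ k = (2 ^ k) ^ 2 by rewrite -expnM mulnC expnM.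
  rewrite mulnA -expnMn [2 ^ k * e]mulnC.
  apply: leq_trans (_ : (b * f) ^ 2 * k.+1 <= _).
    by rewrite leq_mul2r leq_sqr le orbT.
  by rewrite expnMn mulnAC leq_mul2r cb orbT.
exact: square bnd (central_bin _).
Qed.

(* Either a third of [D] is fixed by [iota] or [D] contains many pairs
   [{y, iota y}]; [K] is a set of representatives of the more numerous kind. *)
Lemma level_bound (D : {set V}) (E : {set {set V}}) :
    (forall y, y \in D -> iota y \in D) ->
    (forall T, T \in E -> flip_closed T) ->
    (forall T U, T \in E -> U \in E -> T :\: D = U :\: D ->
       #|T :&: D| = #|U :&: D|) ->
  #|E| ^ 2 * #|D| <= 3 * #|[set T | flip_closed T]| ^ 2.
Proof.
move=> Di clE level.
pose K1 := [set y in D | iota y == y].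
pose K2 := [set y in D | enum_rank y < enum_rank (iota y)].
have K1i : iota @: K1 = K1.
  apply/setP => y; rewrite in_flip_imset // !inE iotaK eq_sym.
  by case: eqP => [->|]; rewrite ?andbF.
have dK2 : [disjoint K2 & iota @: K2].
  rewrite disjoint_subset; apply/subsetP => y; rewrite !inE in_flip_imset // inE iotaK.
  by case/andP=> _ lt; rewrite negb_and -leqNgt (ltnW lt) orbT.
have cardI2 : #|iota @: K2| = #|K2| by rewrite card_imset //; apply: can_inj.
have cD : #|D| <= #|K1| + 2 * #|K2|.
  apply: leq_trans (_ : #|K1 :|: (K2 :|: iota @: K2)| <= _).
    apply: subset_leq_card; apply/subsetP => y yD.
    rewrite !inE in_flip_imset // inE iotaK yD Di //=.
    case: ltngtP => [||/val_inj/enum_rank_inj E1]; rewrite ?orbT //.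
    by rewrite -E1 eqxx.
  apply: leq_trans (leq_card_setU _ _) _; rewrite leq_add2l.
  by apply: leq_trans (leq_card_setU _ _) _; rewrite cardI2; lia.
have b1 : #|E| ^ 2 * #|K1|.+1 <= #|[set T | flip_closed T]| ^ 2.
  apply: (@level_bound_reps K1 D E 1) => //.
  - by move=> y; rewrite inE => /andP[_ /eqP].
  - by rewrite /flip_hull K1i setUid; apply/subsetP => y; rewrite inE => /andP[].
  - by move=> T _; rewrite /flip_hull K1i setUid mul1n.
have b2 : #|E| ^ 2 * #|K2|.+1 <= #|[set T | flip_closed T]| ^ 2.
  apply: (@level_bound_reps K2 D E 2) => //.
  - move=> y yK iyK; have := disjointFr dK2 iyK.
    by rewrite in_flip_imset // iotaK yK.
  - apply/subsetP => y; rewrite in_flip_hull // !inE => /orP[]/andP[]// /Di.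
    by rewrite iotaK.
  - move=> T /flip_closedP Tc; rewrite /flip_hull setIUr cardsU.
    rewrite setIACA setIid (disjoint_setI0 dK2) setI0 cards0 subn0.
    rewrite mul2n -addnn; congr (_ + _).
    rewrite -(card_imset (T :&: K2) (can_inj iotaK)); congr #|pred_of_set _|.
    by apply/setP => y; rewrite in_flip_imset // !inE in_flip_imset // Tc inE.
(* The bounds for [K1] and [K2] are added with weights 1 and 2, which covers [#|D|] and gives the
   constant 3. *)
apply: leq_trans (_ : #|E| ^ 2 * (#|K1|.+1 + 2 * #|K2|.+1) <= _).
  by rewrite leq_mul2l; apply/orP; right; lia.
rewrite mulnDr mulnCA -[3]/(1 + 2) mulnDl mul1n.
by apply: leq_add => //; rewrite leq_mul2l b2 orbT.
Qed.

End FlipClosed.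

(** * Cayley digraphs *)

(** Union bound: at most [(#|T| - k) ^ b] tuples miss a given [D i], so these do not exhaust all
    tuples. *)
Lemma hitting_tuple (T I : finType) (P : pred I) (D : I -> {set T}) k b :
    (forall i, P i -> k <= #|D i|) -> #|P| * (#|T| - k) ^ b < #|T| ^ b ->
  exists X : {ffun 'I_b -> T}, forall i, P i -> exists j, X j \in D i.
Proof.
move=> Dk lt.
pose miss i := [set X : {ffun 'I_b -> T} | X \in ffun_on (mem (~: D i))].
have cmiss i : P i -> #|miss i| <= (#|T| - k) ^ b.
  have mono x y : x <= y -> x ^ b <= y ^ b by case: (b) => // b'; rewrite leq_exp2r.
  move=> Pi; rewrite /miss cardsE card_ffun_on card_ord; apply: mono.
  by rewrite -(cardsC (D i)) -addnBAC ?Dk // leq_addl.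
have : ~~ ([set: {ffun 'I_b -> T}] \subset \bigcup_(i | P i) miss i).
  apply: contraL lt => /subset_leq_card; rewrite cardsT card_ffun card_ord -leqNgt.
  move/leq_trans; apply; apply: leq_trans (card_bigcup_leq _ _) _.
  by rewrite -sum_nat_const; apply: leq_sum.
case/subsetPn => X _ /bigcupP nX; exists X => i Pi.
apply/existsP; apply: contra_notT nX => /existsPn nXi; exists i => //.
by rewrite inE; apply/ffun_onP => j; rewrite inE.
Qed.

Lemma card_setI_geq (T : finType) (A B : {set T}) :
  #|A| + #|B| <= #|T| + #|A :&: B|.
Proof. by rewrite -cardsUI leq_add2r -cardsT subset_leq_card ?subsetT. Qed.

Lemma setI_large (T : finType) (A B : {set T}) :
  3 * #|T| < 4 * #|A| -> #|B| = #|A| -> #|T| < 2 * #|A :&: B|.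
Proof. by have := card_setI_geq A B; lia. Qed.

Lemma setI_majority (T : finType) (A B : {set T}) :
  #|T| < 2 * #|A| -> #|T| < 2 * #|B| -> exists x, x \in A :&: B.
Proof.
by have := card_setI_geq A B => ? ? ?; apply/card_gt0P; lia.
Qed.

Lemma card_setC_quarter (T : finType) (A : {set T}) :
  4 * #|A| <= 3 * #|T| -> #|T| <= 4 * #|~: A|.
Proof. by have := cardsC A; lia. Qed.

Section Groups.
Local Open Scope group_scope.
Variable gT : finGroupType.
Implicit Types (A : {set gT}) (x y z g h d c : gT) (p q : {perm gT}).

(* If more than 3/4 of the elements squared to [d], then more than half of the
   elements would invert a given square root [y] of [d], forcing [y * y = 1]. *)
Lemma card_square_roots d :
  d != 1 -> (4 * #|[set y : gT | y * y == d]%g| <= 3 * #|gT|)%N.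
Proof.
move=> d1; set Q := [set y | _]; rewrite leqNgt; apply/negP => big.
have [y yQ|Q0] := pickP (mem Q); last first.
  by move: big; rewrite (eq_card0 Q0).
pose A := Q :&: [set z | y * z \in Q].
have cQ : #|[set z | y * z \in Q]| = #|Q|.
  rewrite -(card_imset [set z | y * z \in Q] (mulgI y)); apply: eq_card => z.
  by rewrite -(mulKVg y z) (mem_imset _ _ (mulgI y)) inE.
have bigA : (#|gT| < 2 * #|A|)%N.
  exact: setI_large cQ.
have inv z : z \in A -> y ^ z = y^-1.
  rewrite !inE => /andP[/eqP zz /eqP yzyz].
  have yzy : y * z * y = z by apply: (mulIg z); rewrite zz -yzyz !mulgA.
  have yz : y * z = z * y^-1 by rewrite -{2}yzy mulgK.
  by rewrite conjgE yz mulKg.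
have [z0 z0A] : exists z0, z0 \in A.
  by apply/card_gt0P; lia.
(* Elements conjugating [y] to its inverse lie in one coset of the centralizer of [y]; as [A] is
   more than half of the group, that centralizer is everything. *)
have sAC : A \subset 'C[y] :* z0.
  apply/subsetP => z zA; rewrite mem_rcoset cent1C; apply/cent1P/commgP/conjg_fixP.
  by rewrite conjgM inv // -(inv z0) // conjgK.
have := subset_leq_card sAC; rewrite card_rcoset => leC.
have /dvdnP[k Ek] : #|'C[y]| %| #|gT| by rewrite -cardsT; apply: cardSg (subsetT _).
have k2 : (k * #|'C[y]| < 2 * #|'C[y]|)%N.
  by rewrite -Ek; apply: leq_trans bigA _; rewrite leq_mul2l leC orbT.
have n0 : (0 < k * #|'C[y]|)%N by rewrite -Ek -cardsT cardG_gt0.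
have k1 : k = 1%N by nia.
have CT : 'C[y] = [set: gT].
  apply/eqP; rewrite eqEcard subsetT /=.
  apply: leq_trans (_ : #|gT| <= _)%N; first by rewrite cardsT.
  by rewrite Ek k1 mul1n.
have : y \in 'C[z0] by rewrite cent1C CT inE.
move/cent1P/commgP/conjg_fixP => yz0.
case/negP: d1; move: yQ; rewrite !inE => /eqP <-.
by rewrite -{2}[y]invgK -(inv z0 z0A) yz0 mulgV.
Qed.

Definition cay_aut A := digraph_aut (fun g h : gT => h * g^-1 \in A).

(** A tuple of [b] vertices whose arcs distinguish any two vertices is a base: an automorphism is
    determined by its values there. *)
Lemma card_cay_aut A k b :
    (forall d, d != 1 -> (k <= #|[set g | (d * g \in A) != (g \in A)]%g|)%N) ->
    (#|gT| ^ 2 * (#|gT| - k) ^ b < #|gT| ^ b)%N ->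
  (#|cay_aut A| <= #|gT| ^ b)%N.
Proof.
move=> Ak lt.
(* [D u] consists of the vertices with an arc to exactly one of [u.1] and [u.2]. *)
pose D (u : gT * gT) := [set x | (u.1 * x^-1 \in A) != (u.2 * x^-1 \in A)].
have [||X hitX] := @hitting_tuple gT _ [pred u : gT * gT | u.1 != u.2] D k b.
- case=> h h' /= ne; pose d := h * h'^-1.
  have d1 : d != 1 by rewrite -eq_mulgV1.
  apply: leq_trans (Ak d d1) _.
  rewrite -(card_imset _ (inj_comp (mulIg h') invg_inj)).
  apply: subset_leq_card; apply/subsetP => _ /imsetP[g gD ->].
  by move: gD; rewrite !inE /= invMg invgK mulgA mulKVg.
- apply: leq_ltn_trans lt; rewrite leq_mul2r -[(#|gT| ^ 2)%N]/(_ * _)%N -card_prod.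
  by rewrite max_card orbT.
have -> : (#|gT| ^ b = #|{ffun 'I_b -> gT}|)%N by rewrite card_ffun card_ord.
pose res p : {ffun 'I_b -> gT} := [ffun j => p (X j)].
rewrite -(@card_in_imset _ _ res) ?max_card // => p q /digraph_autP pA /digraph_autP qA eqr.
apply/permP => h; apply/eqP; apply: contraT => ne.
have [j] : exists j, X j \in D (h, (p^-1)%g (q h)).
  apply: hitX => /=; apply: contra ne => /eqP E; by rewrite {1}E permKV.
have eqX : p (X j) = q (X j) by have /ffunP/(_ j) := eqr; rewrite !ffunE.
by rewrite inE /= -(pA _ ((p^-1)%g _)) permKV eqX qA eqxx.
Qed.

(** Every map [F x] preserves each [A] compatible with [(p, q)]. If all of them fix more than half
    of the points, any two values of [x] share a point [u] with [q u = u * (x^-1 * p x)], so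
    [x^-1 * p x] is constant and [p] is a right translation. *)
Lemma twist_of_pair p q :
    ~ (exists c, forall x, p x = x * c /\ q x = x * c) ->
  exists f : gT -> gT, [/\ injective f, (#|gT| <= 2 * #|[set g | f g != g]|)%N &
    forall A, (forall g h, (q h * (p g)^-1 \in A) = (h * g^-1 \in A)) ->
      forall g, (f g \in A) = (g \in A)].
Proof.
move=> npq; pose F x h := q (h * x) * (p x)^-1.
have [/existsP[x bigx]|/existsPn small] :=
  boolP [exists x, #|gT| <= 2 * #|[set g | F x g != g]|]%N.
  exists (F x); split=> // [g h /mulIg/perm_inj/mulIg //|A HA g].
  by rewrite HA mulgK.
have half x : (#|gT| < 2 * #|[set u | q u == u * (x^-1 * p x)]%g|)%N.
  have := small x; rewrite -ltnNge -(cardsC [set g | F x g != g]).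
  suff -> : #|~: [set g | F x g != g]| = #|[set u | q u == u * (x^-1 * p x)]| by lia.
  rewrite -(card_imset _ (mulIg x)); apply: eq_card => u.
  rewrite (_ : (u \in _) = (u * x^-1 \in ~: [set g | F x g != g])); last first.
    by rewrite -{1}(mulgKV x u) (mem_imset _ _ (mulIg x)).
  by rewrite !inE negbK /F mulgKV mulgA (can2_eq (mulgKV _) (mulgK _)).
have const x : x^-1 * p x = p 1.
  pose H z := [set u | q u == u * (z^-1 * p z)].
  have [u] : exists u, u \in H x :&: H 1.
    exact: setI_majority (half x) (half 1).
  by rewrite !inE invg1 mul1g => /andP[/eqP -> /eqP/mulgI].
have pE x : p x = x * p 1 by rewrite -(const x) mulKVg.
have [/forallP qE|/forallPn[a qa]] := boolP [forall u, q u == u * p 1].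
  by case: npq; exists (p 1) => x; split; [exact: pE | apply/eqP/qE].
(* Now [p] is the translation by [p 1] while [q] differs from it at [a]; this makes [A] invariant
   under left multiplication by [e], which moves every point. *)
pose e := q a * (a * p 1)^-1.
have e1 : e != 1 by apply: contra qa; rewrite -eq_mulgV1.
exists (mulg e); split=> [||A HA g]; first exact: mulgI.
  rewrite (_ : [set g | _] = [set: gT]) ?cardsT ?leq_pmull //.
  by apply/setP => g; rewrite !inE -{2}[g]mul1g (inj_eq (mulIg g)).
have -> : e * g = q a * (p (g^-1 * a))^-1 by rewrite pE /e !invMg !invgK !mulgA.
by rewrite HA invMg invgK mulgA mulgV mul1g.
Qed.

End Groups.

(** * Set-matrices *)

Section SetMatrices.
Local Open Scope group_scope.
Variables (gT : finGroupType) (m : nat).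
Local Notation V := (gT * 'I_m * 'I_m)%type.
Implicit Types (T U : {set V}) (A B : {set gT}) (p q : {perm gT}) (i j : 'I_m).

(* A set-matrix [S] is encoded as the set of triples [(g, i, j)] with
   [g \in S i j]; it is inverse-closed iff this set is closed under [flip true],
   while [flip false] imposes no condition. *)
Definition flip (b : bool) (v : V) : V :=
  if b then (v.1.1^-1, v.2, v.1.2) else v.

Lemma flipK b : involutive (flip b).
Proof. by case: b => [[[g i] j]|v] //=; rewrite /flip /= invgK. Qed.

Local Notation closed b := (flip_closed (flip b)).

Definition entry T i j : {set gT} := [set g | (g, i, j) \in T].

Definition at_entry i j A : {set V} :=
  [set v | [&& v.1.2 == i, v.2 == j & v.1.1 \in A]].

Lemma card_at_entry i j A : #|at_entry i j A| = #|A|.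
Proof.
have inj : injective (fun g : gT => (g, i, j)) by move=> g h [].
rewrite -(card_imset A inj); apply: eq_card => -[[g i'] j']; rewrite inE /=.
apply/and3P/imsetP => [[/eqP-> /eqP-> gA]|[h hA [-> -> ->]]]; first by exists g.
by rewrite !eqxx.
Qed.

Lemma entry_eq_out T U (Z : {set V}) i j :
    (forall g, (g, i, j) \notin Z) -> U :\: Z = T :\: Z -> entry U i j = entry T i j.
Proof.
move=> ijZ E; apply/setP => g; rewrite !inE.
by have := congr1 (fun X : {set V} => (g, i, j) \in X) E; rewrite !in_setD ijZ.
Qed.

Definition twist_entry i j (f : gT -> gT) (v : V) : V :=
  if (v.1.2 == i) && (v.2 == j) then (f v.1.1, i, j) else v.

Lemma twist_entry_inj i j f : injective f -> injective (twist_entry i j f).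
Proof.
move=> f_inj [[g a] b] [[h c] d]; rewrite /twist_entry /=.
have [/andP[/eqP-> /eqP->]|ab] := boolP ((a == i) && (b == j));
  have [/andP[/eqP-> /eqP->]|cd] := boolP ((c == i) && (d == j)) => // -[].
- by move=> /f_inj->.
- by move=> _ E1 E2; rewrite -E1 -E2 !eqxx in cd.
- by move=> _ E1 E2; rewrite E1 E2 !eqxx in ab.
Qed.

(** This is [twist_bound] confined to one entry: only the entry [(i, j)] and its mirror [(j, i)] are
    varied. *)
Lemma entry_twist_bound b i j (f : gT -> gT) (M D : {set gT}) (F E : {set {set V}}) :
    injective f ->
    (forall g, g \in M -> f g != g /\ (f g, i, j) != flip b (g, i, j)) ->
    E \subset F -> (forall T, T \in E -> closed b T) ->
    (forall T U, T \in F -> closed b U ->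
       (forall k l, (k, l) != (i, j) -> (l, k) != (i, j) ->
          entry U k l = entry T k l) -> U \in F) ->
    (forall T g, T \in E -> (f g \in entry T i j) = (g \in entry T i j) (+) (g \in D)) ->
  exists2 r, (#|M| <= 6 * r)%N & (#|E| * 2 ^ r <= #|F|)%N.
Proof.
move=> f_inj Mf sEF clE Fsat tw.
have [] := @twist_bound _ _ (flipK b) (twist_entry i j f) (at_entry i j M)
  (at_entry i j D) F E _ _ sEF clE.
- exact: twist_entry_inj.
- case=> [[g k] l]; rewrite inE /= => /and3P[/eqP-> /eqP-> gM].
  have [n1 n2] := Mf g gM; rewrite /twist_entry /= !eqxx /=; split=> //.
  by apply: contra n1 => /eqP[->].
- move=> T U TF Uc eqout; apply: (Fsat T) => // k l kl lk.
  apply: entry_eq_out eqout => g; rewrite in_flip_hull; last exact: flipK.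
  rewrite !inE /= negb_or; apply/andP; split.
    by apply: contra kl => /and3P[/eqP-> /eqP-> _].
  case: (b) => /=; first by apply: contra lk => /and3P[/eqP-> /eqP-> _].
  by apply: contra kl => /and3P[/eqP-> /eqP-> _].
- move=> T [[g k] l] TE; rewrite !inE /= => /and3P[/eqP-> /eqP-> gM].
  by have := tw T g TE; rewrite /twist_entry /= !eqxx !inE /=.
by move=> r; rewrite card_at_entry; exists r.
Qed.

(** The total size of row [i], which is the common outdegree of all vertices [(g, i)]. *)
Definition outdeg T i := #|[set v in T | v.1.2 == i]|.

(** Only the diagonal entry [(i, i)] is varied. It is stable under [flip b] and contributes to row
    [i] but not to row [i'], so equality prescribes its size and [level_bound] applies. *)
Lemma equal_outdeg_bound b i i' : i != i' ->
  (#|[set T | closed b T & outdeg T i == outdeg T i']| ^ 2 * #|gT|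
     <= 3 * #|[set T | closed b T]| ^ 2)%N.
Proof.
move=> ii'; set E := [set T | _ & _].
have <- : #|at_entry i i [set: gT]| = #|gT| by rewrite card_at_entry cardsT.
set D := at_entry i i _.
apply: level_bound; first exact: flipK.
- move=> [[g k] l]; rewrite !inE /= /flip; case: b {E} => //=.
  by case/and3P=> -> -> _.
- by move=> T; rewrite inE => /andP[].
have split T : outdeg T i = (#|T :&: D| + #|[set v in T :\: D | v.1.2 == i]|)%N.
  rewrite /outdeg -(cardsID D); congr (_ + _)%N; apply: eq_card => v.
    rewrite !inE; by case: (v \in T) => //=; case: eqP.
  by rewrite !inE andbA.
have other T : outdeg T i' = #|[set v in T :\: D | v.1.2 == i']|.
  apply: eq_card => v; rewrite !inE; case: eqP => [->|]; rewrite ?andbF //.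
  by rewrite eq_sym (negbTE ii').
move=> T U; rewrite !inE => /andP[_ /eqP ET] /andP[_ /eqP EU] eqD.
move: ET EU; rewrite !split !other eqD => <- /eqP.
by rewrite eqn_add2r => /eqP.
Qed.

(** Here [D] is the exact set where left multiplication by [d] changes membership, so that the set
    drives a twist by [mulg d]. The exponent comes from [24 = 4 * 6]. *)
Lemma few_changes_bound b i (d : gT) (D : {set gT}) : d != 1 ->
  (#|[set T | closed b T & [forall g, (d * g \in entry T i i)%g ==
        (g \in entry T i i) (+) (g \in D)]]| * 2 ^ (#|gT| %/ 24)
     <= #|[set T | closed b T]|)%N.
Proof.
move=> d1; set E := [set T | _ & _]; set F := [set T | _].
(* Points with [d * g = g^-1] are discarded, since inverse-closure may already tie [d * g] to [g];
   at least a quarter of the group remains. *)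
pose M := [set g : gT | g * g != d^-1].
have cM : (#|gT| <= 4 * #|M|)%N.
  have dV1 : d^-1 != 1 by rewrite invg_eq1.
  rewrite (_ : M = ~: [set g : gT | g * g == d^-1]).
    exact: card_setC_quarter (card_square_roots dV1).
  by apply/setP => g; rewrite !inE.
have [|||||r leM le] := @entry_twist_bound b i i (mulg d) M D F E (mulgI d).
- move=> g; rewrite inE => gg; split.
    by rewrite -{2}[g]mul1g (inj_eq (mulIg g)).
  rewrite /flip; case: b {E F} => /=; apply/eqP => -[E].
    by case/eqP: gg; apply: (mulgI d); rewrite mulgV mulgA E mulVg.
  by case/eqP: d1; apply: (mulIg g); rewrite mul1g.
- by apply/subsetP => T; rewrite !inE => /andP[].
- by move=> T; rewrite inE => /andP[].
- by move=> T U _ Uc _; rewrite inE.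
- by move=> T g; rewrite inE => /andP[_ /forallP/(_ g)/eqP].
apply: leq_trans le; rewrite leq_mul2l leq_exp2l //.
apply/orP; right; rewrite -(mulKn r (isT : 0 < 24)%N) leq_div2r //.
by apply: leq_trans cM _; rewrite -[24%N]/(4 * 6)%N -mulnA leq_mul2l leM.
Qed.

Definition same_translation p q :=
  [exists c, [forall x, (p x == x * c) && (q x == x * c)]].

Definition compatible p q A :=
  [forall g, forall h, (q h * (p g)^-1 \in A) == (h * g^-1 \in A)].

(** Fixing the two diagonal entries leaves the entry [(i, j)] free, and a twist preserving it moves
    at least half of the points; [12 = 2 * 6]. *)
Lemma compatible_bound b i j A B p q : i != j -> ~~ same_translation p q ->
  (#|[set T | [&& closed b T, entry T i i == A, entry T j j == B
                & compatible p q (entry T i j)]]| * 2 ^ (#|gT| %/ 12)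
     <= #|[set T | [&& closed b T, entry T i i == A & entry T j j == B]]|)%N.
Proof.
move=> ij npq; set E := [set T | _]; set F := [set T | _].
have [|f [f_inj fM fA]] := @twist_of_pair gT p q.
  case=> c pq; case/negP: npq; apply/existsP; exists c; apply/forallP => x.
  by have [-> ->] := pq x; rewrite !eqxx.
have [|||||r leM le] := @entry_twist_bound b i j f [set g | f g != g] set0 F E f_inj.
- move=> g; rewrite inE => fg; split=> //; rewrite /flip; case: b {E F} => /=.
    by apply: contra ij => /eqP[_ -> _].
  by apply: contra fg => /eqP[->].
- by apply/subsetP => T; rewrite !inE => /and4P[-> -> ->].
- by move=> T; rewrite inE => /and4P[].
- move=> T U; rewrite !inE => /and3P[_ Ti Tj] Uc eqUT; rewrite Uc /=.
  rewrite !eqUT ?Ti ?Tj //; apply: contra ij => /eqP[] -> //.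
- move=> T g; rewrite inE => /and4P[_ _ _ cpq]; rewrite in_set0 addbF; apply: fA.
  by move=> x y; apply/eqP; move: cpq => /forallP/(_ x)/forallP/(_ y).
apply: leq_trans le; rewrite leq_mul2l leq_exp2l //.
apply/orP; right; rewrite -(mulKn r (isT : 0 < 12)%N) leq_div2r //.
by apply: leq_trans fM _; rewrite -[12%N]/(2 * 6)%N -mulnA leq_mul2l leM.
Qed.

Definition nonrigid_pair T i j :=
  [exists p in cay_aut (entry T i i), exists q in cay_aut (entry T j j),
    ~~ same_translation p q && compatible p q (entry T i j)].

(** The groups [cay_aut] depend on the diagonal entries alone. Conditioning on these, the union
    bound runs over at most [N ^ 2] pairs of automorphisms fixed in advance. *)
Lemma nonrigid_pair_bound b i j N : i != j ->
  (#|[set T | [&& closed b T, #|cay_aut (entry T i i)| <= N,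
       #|cay_aut (entry T j j)| <= N & nonrigid_pair T i j]]| * 2 ^ (#|gT| %/ 12)
     <= N ^ 2 * #|[set T | closed b T]|)%N.
Proof.
move=> ij; set E := [set T | _]; set F := [set T | _].
pose diag T := (entry T i i, entry T j j).
rewrite -[X in (X * _ <= _)%N]sum1_card -[X in (_ <= _ * X)%N]sum1_card.
rewrite (partition_big diag predT) //= [X in (_ <= _ * X)%N](partition_big diag predT) //=.
rewrite big_distrl big_distrr /=; apply: leq_sum => -[A B] _; rewrite !sum1_card.
set FAB := [set T | [&& closed b T, entry T i i == A & entry T j j == B]].
have -> : #|[pred T | (T \in F) && (diag T == (A, B))]| = #|FAB|.
  by apply: eq_card => T; rewrite !inE xpair_eqE.
pose P (pq : {perm gT} * {perm gT}) := [&& pq.1 \in cay_aut A, pq.2 \in cay_aut B &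
  ~~ same_translation pq.1 pq.2].
pose EAB (pq : {perm gT} * {perm gT}) := [set T | [&& closed b T, entry T i i == A,
  entry T j j == B & compatible pq.1 pq.2 (entry T i j)]].
(* An empty fibre is trivial; otherwise a member [T0] transfers the bound [N] to [A] and [B]. *)
have [T0 /andP[]|none] := pickP [pred T | (T \in E) && (diag T == (A, B))]; last first.
  by rewrite (eq_card0 none).
rewrite inE => /and4P[_ cA cB _] /eqP[EA EB]; rewrite {}EA in cA; rewrite {}EB in cB.
apply: leq_trans (_ : (\sum_(pq | P pq) #|EAB pq|) * 2 ^ (#|gT| %/ 12) <= _)%N.
  rewrite leq_mul2r; apply/orP; right; apply: leq_trans (card_bigcup_leq _ _).
  apply: subset_leq_card; apply/subsetP => T /andP[].
  rewrite inE => /and4P[Tc _ _ /exists_inP[p pA /exists_inP[q qB /andP[npq cpq]]]].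
  rewrite xpair_eqE => /andP[/eqP EA /eqP EB].
  apply/bigcupP; exists (p, q); first by rewrite /P /= -EA -EB pA qB.
  by rewrite inE Tc EA EB !eqxx.
rewrite big_distrl /=.
apply: leq_trans (_ : \sum_(pq | P pq) #|FAB| <= _)%N.
  by apply: leq_sum => pq /and3P[_ _ npq]; apply: compatible_bound.
rewrite sum_nat_const leq_mul2r; apply/orP; right.
apply: leq_trans (_ : #|setX (cay_aut A) (cay_aut B)| <= _)%N.
  by apply: subset_leq_card; apply/subsetP => pq /and3P[pA qB _]; rewrite inE pA qB.
by rewrite cardsX; apply: leq_mul.
Qed.

End SetMatrices.

(** * Automorphisms of [m]-Cayley digraphs *)

Section Rigidity.
Local Open Scope group_scope.
Variables (gT : finGroupType) (m : nat).
Local Notation V := (gT * 'I_m * 'I_m)%type.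
Implicit Types (T : {set V}) (i j : 'I_m).

Definition matrix_of T : set_matrix gT m := (\matrix_(i, j) entry T i j)%R.

Lemma mCay_matrix_of T (u v : gT * 'I_m) :
  mCay (matrix_of T) u v = ((v.1 * u.1^-1, u.2, v.2) \in T).
Proof.
apply/exists_inP/idP => [[s + /eqP ->]|vT].
  by rewrite mxE inE mulgK.
by exists (v.1 * u.1^-1); rewrite ?mulgKV // mxE inE.
Qed.

Lemma card_out_neighbours T (u : gT * 'I_m) :
  #|[set w | mCay (matrix_of T) u w]| = outdeg T u.2.
Proof.
have inj : injective (fun w : gT * 'I_m => (w.1 * u.1^-1, u.2, w.2)).
  by move=> [g i] [h j] [/mulIg /= -> ->].
rewrite /outdeg -(card_imset _ inj); apply: eq_card => -[[g i] j].
rewrite inE /=; apply/imsetP/andP => [[w + [-> -> ->]]|[gij /eqP /= Ei]].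
  by rewrite inE mCay_matrix_of /= => wT; split.
by exists (g * u.1, j); rewrite ?inE ?mCay_matrix_of /= mulgK -?Ei.
Qed.

Lemma translate_inj (x : gT) :
  injective (fun u : gT * 'I_m => (u.1 * x, u.2)).
Proof. by move=> [g i] [h j] [/mulIg /= -> ->]. Qed.

Definition translation (x : gT) : {perm gT * 'I_m} := perm (@translate_inj x).

Lemma translationM : {morph translation : x y / x * y}.
Proof. by move=> x y; apply/permP => u; rewrite permM !permE /= mulgA. Qed.

Lemma isog_of_translations T (i0 : 'I_m) :
    (forall P, P \in digraph_aut (mCay (matrix_of T)) ->
       exists c, forall u, P u = (u.1 * c, u.2)) ->
  digraph_aut (mCay (matrix_of T)) \isog [set: gT].
Proof.
move=> form; rewrite isog_sym.
apply/isogP; exists (Morphism (in2W translationM : {in [set: gT] &, _})).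
  apply/injmP => x y _ _ /permP/(_ (1, i0)); rewrite /= !permE /= !mul1g.
  by case.
rewrite morphimE setTI; apply/setP => P; apply/imsetP/idP => [[x _ ->]|PA].
  apply/digraph_autP => u v; rewrite /= !permE /=; exact: mCay_right_translation.
have [c Pc] := form P PA; exists c; rewrite ?inE //.
by apply/permP => u; rewrite Pc permE.
Qed.

(** Distinct outdegrees force an automorphism to preserve each copy of the group, and rigidity of
    the pairs [(i0, j)] makes it the same right translation on all copies. *)
Lemma isog_of_rigid T i0 j0 : i0 != j0 -> injective (outdeg T) ->
    (forall j, i0 != j -> ~~ nonrigid_pair T i0 j) ->
  digraph_aut (mCay (matrix_of T)) \isog [set: gT].
Proof.
move=> ij0 deg rig; apply: (isog_of_translations i0) => P /digraph_autP PA.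
have row u : (P u).2 = u.2.
  apply: deg; rewrite -!card_out_neighbours.
  rewrite -(card_imset [set w | mCay (matrix_of T) u w] (@perm_inj _ P)).
  apply: eq_card => w.
  by rewrite -(permKV P w) (mem_imset _ _ (@perm_inj _ P)) !inE PA.
pose phi i g := (P (g, i)).1.
have PE g i : P (g, i) = (phi i g, i).
  by rewrite [LHS]surjective_pairing row.
have phi_inj i : injective (phi i).
  move=> g h E1; have : P (g, i) = P (h, i) by rewrite !PE E1.
  by move/perm_inj => [].
have phiA i j g h :
    (phi j h * (phi i g)^-1 \in entry T i j) = (h * g^-1 \in entry T i j).
  by have := PA (g, i) (h, j); rewrite !mCay_matrix_of !PE /= !inE.
have pair j : i0 != j -> exists c, forall x, phi i0 x = x * c /\ phi j x = x * c.
  move=> ij; pose p i := perm (phi_inj i).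
  have pcay i : p i \in cay_aut (entry T i i).
    by apply/digraph_autP => g h; rewrite !permE phiA.
  have : same_translation (p i0) (p j).
    apply: contraT => npq; case/negP: (rig j ij).
    apply/exists_inP; exists (p i0) => //; apply/exists_inP; exists (p j) => //.
    rewrite npq; apply/forallP => g; apply/forallP => h; rewrite !permE.
    by rewrite phiA.
  case/existsP=> c /forallP pc; exists c => x.
  by have /andP[/eqP + /eqP] := pc x; rewrite !permE => -> ->.
(* The copy [j0] provides the constant [c]; the constants from other copies agree with it, both
   being [phi i0 1]. *)
have [c pc] := pair j0 ij0; exists c => -[g i]; rewrite PE /=.
have [<-|/pair[d pd]] := eqVneq i0 i; first by have [-> _] := pc g.
have [_ ->] := pd g; have [E1 _] := pc 1; have [E2 _] := pd 1.
by move: E2; rewrite E1 !mul1g => ->.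
Qed.

End Rigidity.

(** * Counting *)

Definition bitlen n := (trunc_log 2 n).+1.

Lemma ltn_bitlen n : n < 2 ^ bitlen n.
Proof. exact: trunc_log_ltn. Qed.

Lemma cube_bitlen_small C : exists N, forall n, N <= n -> C * bitlen n ^ 3 <= n.
Proof.
(* This makes [512 * C <= l], so that [512 * C * l.+1 ^ 3 <= l.+1 ^ 4], which [pow4] bounds by
   [512 * 2 ^ l]. *)
exists (2 ^ (512 * C)) => n le; rewrite /bitlen; set l := trunc_log 2 n.
have n0 : 0 < n by apply: leq_trans le; rewrite expn_gt0.
have le2 : 2 ^ l <= n by apply: trunc_logP.
have leL : 512 * C <= l by apply: trunc_log_max.
have pow4 L : L ^ 4 <= 256 * 2 ^ L.
  have lt : L <= 4 * 2 ^ (L %/ 4).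
    apply: leq_trans (_ : 4 * (L %/ 4).+1 <= _); first by lia.
    by rewrite leq_mul2l ltn_expl.
  apply: leq_trans (_ : (4 * 2 ^ (L %/ 4)) ^ 4 <= _); first by rewrite leq_exp2r.
  by rewrite expnMn -expnM leq_mul2l leq_exp2l // leq_trunc_div.
apply: leq_trans le2; have := pow4 l.+1; rewrite expnS => le4.
have : (512 * C) * l.+1 ^ 3 <= 512 * 2 ^ l.
  rewrite -[512]/(256 * 2) -[X in _ <= X]mulnA -expnS; apply: leq_trans (pow4 l.+1).
  by rewrite [l.+1 ^ 4]expnS leq_mul2r (leq_trans leL) ?orbT.
by rewrite -mulnA leq_pmul2l.
Qed.

(** Bernoulli's inequality [(1 + k / a) ^ q >= 1 + q * k / a] with [a = n - k <= q * k]. *)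
Lemma halving_power n k q : k <= n <= q * k -> 0 < q -> 2 * (n - k) ^ q <= n ^ q.
Proof.
move=> /andP[kn nqk] q0; have := subnK kn; set a := n - k => En; rewrite -En.
have bern t : a ^ t * (a + t * k) <= (a + k) ^ t * a.
  elim: t => [|t IH]; first by rewrite mul0n addn0 leqnn.
  have le : a ^ t <= (a + k) ^ t by case: (t) => // t'; rewrite leq_exp2r ?leq_addr.
  by rewrite !expnS; move: IH le; set x := a ^ t; set y := (a + k) ^ t; nia.
have [->|a0] := posnP a; first by rewrite exp0n ?muln0.
rewrite -(leq_pmul2r a0); apply: leq_trans (bern q).
by rewrite mulnAC mulnC leq_mul2l; apply/orP; right; lia.
Qed.

(** * Choice of the numerical parameters *)

Section SizeEstimates.
Variables (n L : nat).
(** [few] is the threshold for the number of membership changes. A block of [50 * L] random points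
    misses a set of size [few] with probability at most 1/2; [2 * L] blocks handle all
    [n ^ 2 < 2 ^ (2 * L)] pairs. *)
Definition few := (n %/ (50 * L)).+1.
Definition base_size := 50 * L * (2 * L).
Hypotheses (L0 : 0 < L) (nL : 3000 * L ^ 3 <= n) (ltn2 : n < 2 ^ L).

Let L3 : L <= L ^ 3.
Proof. by rewrite -{1}(expn1 L) leq_pexp2l. Qed.

Lemma hitting_arith : n ^ 2 * (n - few) ^ base_size < n ^ base_size.
Proof.
have n0 : 0 < n by lia.
have [q Eq q0] : exists2 q, q = 50 * L & 0 < q by exists (50 * L); lia.
have nq : n < q * few by rewrite mulnC /few -Eq; apply: ltn_ceil.
have kn : few <= n by rewrite /few ltn_divLR; nia.
have half : 2 * (n - few) ^ q <= n ^ q.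
  by apply: halving_power => //; rewrite kn ltnW.
have half2 : 2 ^ (2 * L) * (n - few) ^ base_size <= n ^ base_size.
  by rewrite /base_size -Eq !(expnM _ q) -expnMn leq_exp2r //; lia.
have n2 : n ^ 2 < 2 ^ (2 * L) by rewrite mulnC expnM ltn_exp2r.
have [->|a0] := posnP ((n - few) ^ base_size); first by rewrite muln0 expn_gt0 n0.
by apply: leq_trans half2; rewrite ltn_pmul2r.
Qed.

Variable m : nat.
Hypothesis mn : m <= n.

(** The factor [m * n * n.+1 ^ few] counts the choices of an index, a shift and a set of changes;
    the extra [n] makes the failure proportion at most [1 / n]. *)
Lemma few_changes_arith : n * (m * n * n.+1 ^ few) <= 2 ^ (n %/ 24).
Proof.
have le2 : n <= 2 ^ L by apply: ltnW.
apply: leq_trans (_ : 2 ^ (L * (few + 3)) <= _).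
  rewrite expnM expnD (expnS _ 2) (expnS _ 1) expn1.
  have lef : n.+1 ^ few <= (2 ^ L) ^ few by rewrite leq_exp2r.
  rewrite [m * n * _]mulnC mulnCA; apply: leq_mul => //.
  by rewrite [m * n]mulnC; apply: leq_mul => //; apply: leq_mul => //; apply: leq_trans le2.
rewrite leq_exp2l // leq_divRL //.
have := leq_trunc_div n (50 * L); rewrite /few; set t := n %/ _.
by move: nL L3; set z := L ^ 3; nia.
Qed.

Lemma nonrigid_arith : n * (m * (n ^ base_size) ^ 2) <= 2 ^ (n %/ 12).
Proof.
have le2 : n <= 2 ^ L by apply: ltnW.
apply: leq_trans (_ : 2 ^ (L * (2 * base_size + 2)) <= _).
  rewrite expnM expnD mulnC -mulnA [X in _ <= X]mulnC [X in _ <= X]mulnC.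
  have : n ^ base_size <= (2 ^ L) ^ base_size.
    by rewrite leq_exp2r // /base_size !muln_gt0 L0.
  rewrite [2 * base_size]mulnC expnM -leq_sqr => le.
  rewrite mulnCA; apply: leq_mul => //.
  by rewrite expnS expn1; apply: leq_mul => //; apply: leq_trans le2.
(* The exponent costs [2400 * L ^ 3 + 24 * L], within the assumed [3000 * L ^ 3 <= n]. *)
rewrite leq_exp2l // leq_divRL // /base_size.
have : L * (2 * (50 * L * (2 * L)) + 2) * 12 = 2400 * L ^ 3 + 24 * L.
  by rewrite !expnS expn0; lia.
by move=> ->; move: nL L3; set z := L ^ 3; lia.
Qed.

End SizeEstimates.

(** Encoding sets of at most [k] elements by [k] optional values bounds their number by
    [(#|T| + 1) ^ k]. *)
Definition some_values (T : finType) k (F : {ffun 'I_k -> option T}) : {set T} :=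
  [set g | [exists x, F x == Some g]].

Lemma some_values_onto (T : finType) k (D : {set T}) :
  #|D| <= k -> exists F : {ffun 'I_k -> option T}, some_values F = D.
Proof.
rewrite cardE => Dk; pose s := map Some (enum D).
exists [ffun x : 'I_k => nth None s x]; apply/setP => g; rewrite inE.
have -> : (g \in D) = (Some g \in s).
  by rewrite mem_map ?mem_enum // => x y [].
apply/existsP/idP => [[x]|gs].
  rewrite ffunE => /eqP; have [lt <-|ge] := ltnP x (size s); first exact: mem_nth.
  by rewrite nth_default.
have lt : index (Some g) s < k.
  by apply: leq_trans Dk; rewrite -[size _](size_map Some) index_mem.
by exists (Ordinal lt); rewrite ffunE nth_index.
Qed.

Section Counting.
Variables (gT : finGroupType) (m : nat) (b : bool).
Local Notation V := (gT * 'I_m * 'I_m)%type.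
Local Notation n := #|gT|.
Local Notation closed := (flip_closed (flip b)).
Implicit Types (T : {set V}) (i j : 'I_m).

Definition all_closed : {set {set V}} := [set T | closed T].
Definition rigid_closed : {set {set V}} :=
  [set T | closed T & digraph_aut (mCay (matrix_of T)) \isog [set: gT]].
Definition equal_outdeg i j : {set {set V}} :=
  [set T | closed T & outdeg T i == outdeg T j].

(* Only two equal outdegrees have non-negligible probability, of order
   [n ^ (-1/2)]; [e] counts the exponentially rare failures. *)
Lemma closed_count : 1 < m -> m <= n -> 3000 * bitlen n ^ 3 <= n ->
  exists2 e, e * n <= 2 * #|all_closed| &
    #|all_closed| <= #|rigid_closed| +
      \sum_(p : 'I_m * 'I_m | p.1 < p.2) #|equal_outdeg p.1 p.2| + e.
Proof.
move=> m2 mn nL; set L := bitlen n in nL.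
have L0 : 0 < L by [].
have ltL : n < 2 ^ L by apply: ltn_bitlen.
pose k := few n L; pose B := n ^ base_size L.
pose i0 : 'I_m := Ordinal (ltnW m2); pose j0 : 'I_m := Ordinal m2.
pose I2 := ('I_m * gT * {ffun 'I_k -> option gT})%type.
pose changes (t : I2) : {set {set V}} := [set T | closed T &
  [forall g, (t.1.2 * g \in entry T t.1.1 t.1.1)%g ==
     (g \in entry T t.1.1 t.1.1) (+) (g \in some_values t.2)]].
(* [E2]: some nontrivial shift changes few memberships in a diagonal entry. [E3] below: some pair
   [(i0, j)] is not rigid although both diagonal groups are small. *)
pose E2 := \bigcup_(t : I2 | t.1.2 != 1%g) changes t.
pose nonrigid j : {set {set V}} := [set T | [&& closed T,
  #|cay_aut (entry T i0 i0)| <= B, #|cay_aut (entry T j j)| <= B & nonrigid_pair T i0 j]].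
pose E3 := \bigcup_(j | i0 != j) nonrigid j.
have e2 : #|E2| * n <= #|all_closed|.
  have p0 : 0 < 2 ^ (n %/ 24) by rewrite expn_gt0.
  rewrite -(leq_pmul2r p0) mulnAC.
  apply: leq_trans (_ : #|{: I2}| * #|all_closed| * n <= _).
    rewrite leq_mul2r; apply/orP; right.
    apply: leq_trans (_ : (\sum_(t : I2 | t.1.2 != 1%g) #|changes t|) * 2 ^ (n %/ 24) <= _).
      by rewrite leq_mul2r card_bigcup_leq orbT.
    rewrite big_distrl /=.
    apply: leq_trans (_ : \sum_(t : I2 | t.1.2 != 1%g) #|all_closed| <= _).
      by apply: leq_sum => t t1; apply: few_changes_bound.
    by rewrite sum_nat_const leq_mul2r max_card orbT.
  rewrite mulnAC [X in _ <= X]mulnC leq_mul2r; apply/orP; right.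
  have := few_changes_arith L0 nL ltL mn; apply: leq_trans.
  by rewrite mulnC !card_prod card_ffun card_option !card_ord.
have e3 : #|E3| * n <= #|all_closed|.
  have p0 : 0 < 2 ^ (n %/ 12) by rewrite expn_gt0.
  rewrite -(leq_pmul2r p0) mulnAC.
  apply: leq_trans (_ : m * (B ^ 2 * #|all_closed|) * n <= _).
    rewrite leq_mul2r; apply/orP; right.
    apply: leq_trans (_ : (\sum_(j | i0 != j) #|nonrigid j|) * 2 ^ (n %/ 12) <= _).
      by rewrite leq_mul2r card_bigcup_leq orbT.
    rewrite big_distrl /=.
    apply: leq_trans (_ : \sum_(j | i0 != j) (B ^ 2 * #|all_closed|) <= _).
      by apply: leq_sum => j ij; apply: nonrigid_pair_bound.
    rewrite sum_nat_const leq_mul2r -[X in _ <= X]card_ord max_card orbT //.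
  rewrite mulnA mulnAC [X in _ <= X]mulnC leq_mul2r; apply/orP; right.
  by have := nonrigid_arith L0 nL ltL mn; apply: leq_trans; rewrite mulnC.
exists (#|E2| + #|E3|); first by rewrite mulnDl mul2n -addnn leq_add.
pose E1 := \bigcup_(p : 'I_m * 'I_m | p.1 < p.2) equal_outdeg p.1 p.2.
apply: leq_trans (_ : #|rigid_closed :|: E1 :|: (E2 :|: E3)| <= _); last first.
  apply: leq_trans (leq_card_setU _ _) _; apply: leq_add; last exact: leq_card_setU.
  by apply: leq_trans (leq_card_setU _ _) _; rewrite leq_add2l card_bigcup_leq.
apply: subset_leq_card; apply/subsetP => T; rewrite inE => Tc.
apply: contraT; rewrite !in_setU !negb_or => /andP[/andP[nG n1] /andP[n2 n3]].
case/negP: nG; rewrite inE Tc /=.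
(* Outside [E2] every nontrivial shift changes at least [k] memberships, so the diagonal groups are
   small. *)
have small i : #|cay_aut (entry T i i)| <= B.
  apply: (@card_cay_aut _ _ k); last exact: hitting_arith L0 nL ltL.
  move=> d d1; rewrite leqNgt; apply: contra n2 => /ltnW /some_values_onto[F EF].
  apply/bigcupP; exists (i, d, F) => //; rewrite inE Tc; apply/forallP => g /=.
  by rewrite EF [in X in _ (+) X]inE; do 2!case: (_ \in entry _ _ _).
apply: (isog_of_rigid (i0 := i0) (j0 := j0)) => //.
  move=> i j eqd; apply/val_inj; case: (ltngtP i j) => // lt; case/negP: n1.
    by apply/bigcupP; exists (i, j) => //; rewrite inE Tc eqd eqxx.
  by apply/bigcupP; exists (j, i) => //; rewrite inE Tc eqd eqxx.
move=> j ij; apply: contra n3 => nr; apply/bigcupP; exists j => //.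
by rewrite inE Tc !small.
Qed.

End Counting.

(** * Set-matrices as sets of triples *)

Section Encoding.
Variables (gT : finGroupType) (m : nat).
Local Notation V := (gT * 'I_m * 'I_m)%type.

Lemma matrix_of_bij : bijective (@matrix_of gT m).
Proof.
exists (fun S : set_matrix gT m => [set v : V | v.1.1 \in S v.1.2 v.2]) => [T|S].
  by apply/setP => -[[g i] j]; rewrite inE mxE inE.
by apply/matrixP => i j; rewrite mxE; apply/setP => g; rewrite !inE.
Qed.

Lemma card_matrix_of (Q : pred (set_matrix gT m)) :
  #|Q| = #|[set T : {set V} | Q (matrix_of T)]|.
Proof.
rewrite -cardsE -(on_card_preimset (onW_bij _ matrix_of_bij)).
by apply: eq_card => T; rewrite !inE.
Qed.

Lemma inverse_closed_matrix_of (T : {set V}) :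
  inverse_closed (matrix_of T) = flip_closed (flip true) T.
Proof.
apply/forallP/flip_closedP => [H [[g i] j]|H i].
  have /forallP/(_ j)/eqP/setP/(_ g^-1)%g := H i.
  by rewrite !mxE !inE invgK.
apply/forallP => j; apply/eqP/setP => g; rewrite !mxE !inE.
by rewrite -(H (g, j, i)).
Qed.

End Encoding.

(** * From counts to real proportions *)

Lemma card_ltn_pairs m : 2 * #|[pred p : 'I_m * 'I_m | p.1 < p.2]| = m * m.-1.
Proof.
rewrite -sum1_card /= -(pair_big_dep xpredT (fun i j : 'I_m => i < j) (fun _ _ => 1)) /=.
rewrite (exchange_big_dep xpredT) //=.
have -> : \sum_(j < m) \sum_(i < m | i < j) 1 = \sum_(j < m) j.
  apply: eq_bigr => j _; rewrite -[RHS]card_ord -sum1_card.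
  by rewrite (big_ord_widen m (fun _ => 1)) ?(ltnW (ltn_ord j)).
by rewrite -(big_mkord xpredT id) bin2_sum -mul_bin_diag bin1.
Qed.

Local Open Scope ring_scope.

Lemma ler_of_sqr_bound (R : realType) (x n C : nat) :
  (x ^ 2 * n <= 3 * C ^ 2)%N -> x%:R * Num.sqrt n%:R <= 2 * C%:R :> R.
Proof.
move=> le; rewrite -(@ler_pXn2r _ 2) // ?nnegrE ?mulr_ge0 ?sqrtr_ge0 //.
rewrite !exprMn sqr_sqrtr // -!natrX -!natrM ler_nat.
by apply: leq_trans le _; rewrite leq_mul2r orbT.
Qed.

(** The equal outdegrees cost [(m^2 - m) / sqrt n]. The rare failures cost at most [2 / n], which is
    strictly below [2 / sqrt n <= m / sqrt n]. *)
Lemma ratio_bound (R : realType) (m n C G S e : nat) :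
    (1 < m)%N -> (1 < n)%N -> (0 < C)%N -> (e * n <= 2 * C)%N ->
    (C <= G + S + e)%N ->
    S%:R * Num.sqrt n%:R <= (m * m.-1 * C)%:R :> R ->
  G%:R / C%:R > 1 - m%:R ^+ 2 / Num.sqrt n%:R :> R.
Proof.
move=> m1 n1 C0 en CG S1; set s := Num.sqrt n%:R in S1 *.
have s1 : 1 < s by rewrite -sqrtr1 ltr_sqrt ?ltr1n // ltr0n ltnW.
have s0 : 0 < s by apply: lt_trans s1.
have ss : s * s = n%:R by rewrite -expr2 sqr_sqrtr.
have c0 : 0 < C%:R :> R by rewrite ltr0n.
rewrite ltr_pdivlMr // mulrBl mul1r mulrAC ltrBlDr -ltrBlDl ltr_pdivlMr //.
have CG' : C%:R <= G%:R + S%:R + e%:R :> R by rewrite -!natrD ler_nat.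
have es : e%:R * s * s <= 2 * C%:R by rewrite -mulrA ss -!natrM ler_nat.
have es2 : e%:R * s < 2 * C%:R.
  have := es; have e0 : 0 <= e%:R * s :> R by rewrite mulr_ge0 // ltW.
  by move: e0; move: (e%:R * s) => z; nra.
have m2 : (m * m.-1 * C)%:R = (m%:R ^+ 2 - m%:R) * C%:R :> R.
  by case: (m) m1 => // k _ /=; rewrite !natrM -natr1; ring.
have mge : 2 <= m%:R :> R by rewrite ler_nat.
rewrite m2 in S1; have : (C%:R - G%:R) * s <= (S%:R + e%:R) * s.
  by rewrite ler_pM2r //; lra.
have : 2 * C%:R <= m%:R * C%:R :> R by rewrite ler_pM2r.
by move: S1 es2; lra.
Qed.

Lemma rigid_ratio (R : realType) (m : nat) (gT : finGroupType) b :
    (1 < m)%N -> (m <= #|gT|)%N -> (3000 * bitlen #|gT| ^ 3 <= #|gT|)%N ->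
  #|rigid_closed gT m b|%:R / #|all_closed gT m b|%:R
    > 1 - m%:R ^+ 2 / Num.sqrt #|gT|%:R :> R.
Proof.
move=> m1 mn nL; have [e en le] := closed_count b m1 mn nL.
apply: ratio_bound en le _ => //; first exact: leq_trans m1 mn.
  by apply/card_gt0P; exists set0; rewrite inE; apply/flip_closedP => y; rewrite !inE.
rewrite natr_sum mulr_suml.
(* Each of the [m (m - 1) / 2] pairs costs at most [2 / sqrt n], the constant 3 under the square
   being relaxed to 4. *)
apply: le_trans (_ : \sum_(p : 'I_m * 'I_m | (p.1 < p.2)%N) 2 * #|all_closed gT m b|%:R <= _).
  apply: ler_sum => p lt; apply: ler_of_sqr_bound; apply: equal_outdeg_bound.
  by rewrite neq_ltn lt.
by rewrite sumr_const -[X in X <= _]mulr_natl -card_ltn_pairs !natrM mulrCA mulrA.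
Qed.

Theorem theorem1p7 (R : realType) (m : nat) (hm : (2 <= m)%N) :
  exists N : nat, forall gT : finGroupType, (N <= #|gT|)%N ->
    proportion R predT (@is_DMSR gT m)
      > 1 - m%:R ^+ 2 / Num.sqrt #|gT|%:R
    /\
    proportion R (@inverse_closed gT m) (@is_GMSR gT m)
      > 1 - m%:R ^+ 2 / Num.sqrt #|gT|%:R.
Proof.
have [N0 HN] := cube_bitlen_small 3000.
exists (maxn N0 m) => gT; rewrite geq_max => /andP[/HN nL mn].
have ratio b := rigid_ratio R b hm mn nL.
(* Digraphs are the case [b = false], where [flip] is the identity and every set is closed. *)
have closedF (T : {set gT * 'I_m * 'I_m}) : flip_closed (flip false) T.
  by apply/flip_closedP.
rewrite /proportion !card_matrix_of; split.
  have := ratio false.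
  have -> : rigid_closed gT m false = [set T | is_DMSR (matrix_of T)].
    by apply/setP => T; rewrite !inE closedF.
  suff -> : all_closed gT m false = [set T | predT (matrix_of T)] by [].
  by apply/setP => T; rewrite !inE closedF.
have := ratio true.
have -> : rigid_closed gT m true =
    [set T | inverse_closed (matrix_of T) && is_GMSR (matrix_of T)].
  by apply/setP => T; rewrite !inE /is_GMSR inverse_closed_matrix_of andbA andbb.
suff -> : all_closed gT m true = [set T | inverse_closed (matrix_of T)] by [].
by apply/setP => T; rewrite !inE inverse_closed_matrix_of.
Qed.
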